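(* Assume (C1q) holds with rate $\sigma_1$, put $Q:=\max\{\sigma_1(b_A-1)-1,0\}$ and let $K\in\mathbb{N}^*$ with $K\ge\max\left\{\|x_Q-p\|,\frac{\|u-Ap\|}{\gamma}\right\}$. Assume that $(x_n)$ is $(\tilde T_n)$-asymptotically regular with rate $\Phi:\mathbb{N}\to\mathbb{N}$ such that $\Phi(k)\ge Q$ for all $k\in\mathbb{N}$, and that $\tau:\mathbb{N}\to\mathbb{N}$ is a monotone function satisfying, for all $k,m\in\mathbb{N}$ and all $x\in\overline{B}_K(p)$: $$\|x-\tilde T_m x\|\le\frac{1}{\tau(k)+1}\quad\text{implies}\quad\forall i<l\ \left(\|x-T_ix\|<\frac{1}{k+1}\right).$$ Then $(x_n)$ is $T_i$-asymptotically regular for all $0\le i\le l-1$ with rate $\tilde\phi(k)=\Phi(\tau(k))$.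
   Context: $\mathbb{N}=\{0,1,2,\dots\}$, $\mathbb{N}^*=\mathbb{N}\setminus\{0\}$; monotone means nondecreasing; $\overline{B}_K(p)$ is the closed ball of radius $K$ centred at $p$. A function $\phi:\mathbb{N}\to\mathbb{N}$ is a rate of $U$-asymptotic regularity of $(x_n)$, for a mapping $U$ on $H$, if $\forall k\,\forall n\ge\phi(k)$: $\|x_n-Ux_n\|\le\frac1{k+1}$; it is a rate of $(U_n)$-asymptotic regularity, for a sequence $(U_n)$ of mappings on $H$, if $\forall k\,\forall n\ge\phi(k)$: $\|x_n-U_nx_n\|\le\frac1{k+1}$. Setting: $H$ is a real Hilbert space; $A$ is a self-adjoint bounded linear operator on $H$ with $\langle Ax,x\rangle\ge\gamma\|x\|^2$ for all $x\in H$, where $0<\gamma\le1$. $l\in\mathbb{N}$, $l\ge1$, and $T_0,\dots,T_{l-1}:H\to H$ are nonexpansive with $F:=\bigcap_{i=0}^{l-1}\mathrm{Fix}(T_i)\ne\emptyset$; for $n\ge l$, $T_n:=T_{n\bmod l}$; $\tilde T_i:=T_{i+l}\cdots T_{i+1}$ (composition) for $i\in\mathbb{N}$. $u\in H$, $(\alpha_n)_{n\in\mathbb{N}}\subset(0,1]$, and $(x_n)$ is Xu's iteration: $x_0\in H$, $x_{n+1}=(I-\alpha_{n+1}A)T_{n+1}x_n+\alpha_{n+1}u$. Take $p\in F$ and $b_A\in\mathbb{N}^*$ with $b_A\ge\|A\|$. (C1q): $\sigma_1:\mathbb{N}\to\mathbb{N}$ is increasing (nondecreasing) and $\forall k\,\forall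 n\ge\sigma_1(k)$: $\alpha_n\le\frac1{k+1}$. *)

(* Defs.v *)
From mathcomp Require Import all_boot all_order all_algebra.
From mathcomp Require Import all_classical all_reals all_analysis.

Set Implicit Arguments.
Unset Strict Implicit.
Unset Printing Implicit Defensive.

Import Order.TTheory GRing.Theory Num.Theory.
Import numFieldNormedType.Exports.

Local Open Scope classical_set_scope.
Local Open Scope ring_scope.

(* A real Hilbert space is a complete normed module H over R : realType with a
   form inner : {dot H for idfun} (bilinear, symmetric, positive definite)
   that induces the norm of H. *)
Definition induces_norm (R : realType) (H : completeNormedModType R)
    (inner : {dot H for (idfun : R -> R)}) : Prop :=
  forall x : H, `|x| = Num.sqrt (inner x x).

Definition bounded_operator (R : realType) (H : normedModType R)
    (A : {linear H -> H}) : Prop :=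
  exists M : R, forall x : H, `|A x| <= M * `|x|.

(* [sup] returns 0 on sets without an upper bound, so this is the operator norm
   only when A is bounded. *)
Definition opnorm (R : realType) (H : normedModType R)
    (A : {linear H -> H}) : R :=
  sup [set `|A x| | x in [set x : H | `|x| <= 1]].

Definition self_adjoint (R : realType) (H : completeNormedModType R)
    (inner : {dot H for (idfun : R -> R)}) (A : {linear H -> H}) : Prop :=
  forall x y : H, inner (A x) y = inner x (A y).

Definition strongly_positive (R : realType) (H : completeNormedModType R)
    (inner : {dot H for (idfun : R -> R)}) (A : {linear H -> H})
    (gamma : R) : Prop :=
  forall x : H, gamma * `|x| ^+ 2 <= inner (A x) x.

Definition nonexpansive (R : realType) (H : normedModType R)
    (U : H -> H) : Prop :=
  forall x y : H, `|U x - U y| <= `|x - y|.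

Definition Fix (X : Type) (U : X -> X) : set X := [set x | U x = x].

(* T_n := T_(n mod l), which is T_n itself for n < l. *)
Definition cyclic (X : Type) (l : nat) (hl : (0 < l)%N)
    (T : 'I_l -> X -> X) (n : nat) : X -> X :=
  T (Ordinal (ltn_pmod n hl)).

(* T_(i+m) o ... o T_(i+1), with T_(i+1) applied first. *)
Fixpoint compose_from (X : Type) (T : nat -> X -> X) (i m : nat) : X -> X :=
  if m is m'.+1 then T (i + m'.+1)%N \o compose_from T i m' else idfun.

Definition Ttilde (X : Type) (l : nat) (hl : (0 < l)%N)
    (T : 'I_l -> X -> X) (i : nat) : X -> X :=
  compose_from (cyclic hl T) i l.

Definition xu_iteration (R : realType) (H : normedModType R)
    (A : {linear H -> H}) (T : nat -> H -> H) (u : H) (alpha : nat -> R)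
    (x : nat -> H) : Prop :=
  forall n : nat,
    x n.+1 = (idfun \- alpha n.+1 \*: A) (T n.+1 (x n)) + alpha n.+1 *: u.

Definition regularity_rate (R : realType) (H : normedModType R)
    (U : H -> H) (x : nat -> H) (phi : nat -> nat) : Prop :=
  forall k n : nat, (phi k <= n)%N -> `|x n - U (x n)| <= k.+1%:R^-1.

Definition seq_regularity_rate (R : realType) (H : normedModType R)
    (U : nat -> H -> H) (x : nat -> H) (phi : nat -> nat) : Prop :=
  forall k n : nat, (phi k <= n)%N -> `|x n - U n (x n)| <= k.+1%:R^-1.

Definition nat_monotone (f : nat -> nat) : Prop :=
  {homo f : m n / (m <= n)%N}.

Definition C1q (R : realType) (alpha : nat -> R) (sigma1 : nat -> nat) : Prop :=
  nat_monotone sigma1 /\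
  forall k n : nat, (sigma1 k <= n)%N -> alpha n <= k.+1%:R^-1.

(* Main.v *)
(* If a <= 1 / ||A||, then I - a A is self-adjoint with values of its quadratic
   form between 0 and (1 - a gamma) ||x||^2, so ||I - a A|| <= 1 - a gamma. From
   x_{n+1} - p = (I - a A) (T_{n+1} x_n - p) + a (u - A p) with a = alpha_{n+1},
   the bound ||x_n - p|| <= K propagates from n = Q on: (1 - a gamma) K +
   a gamma K = K. Hence x_n lies in the ball where tau applies. *)
Require Import Defs.
From mathcomp Require Import all_boot all_order all_algebra.
From mathcomp Require Import all_classical all_reals all_analysis.
From mathcomp Require Import ring lra.

Import Order.TTheory GRing.Theory Num.Theory.
Import numFieldNormedType.Exports.

Local Open Scope classical_set_scope.
Local Open Scope ring_scope.

(** By homogeneity: the norm of [A] at the unit vector [x / |x|] lies in the set whose supremum is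
    [opnorm A]. Boundedness of [A] rules out the default value of [sup]. *)
Lemma opnorm_bound (R : realType) (H : normedModType R) (A : {linear H -> H}) :
  bounded_operator A -> forall x : H, `|A x| <= opnorm A * `|x|.
Proof.
move=> [M hM] x; have [->|x0] := eqVneq x 0.
  by rewrite linear0 !normr0 mulr0.
have nx : 0 < `|x| by rewrite normr_gt0.
rewrite -ler_pdivrMr //; apply: ub_le_sup.
  (* [M] has no assumed sign; passing to its absolute value lets [|y| <= 1] be used. *)
  exists `|M| => _ [y /= y1 <-]; apply: le_trans (hM y) _.
  apply: le_trans (ler_norm _) _; rewrite normrM normr_id.
  by rewrite ler_piMr.
exists (`|x|^-1 *: x) => /=.
  by rewrite normrZ normfV normr_id mulVf // gt_eqF.
by rewrite linearZ normrZ normfV normr_id mulrC.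
Qed.

Section Hilbert.
Context {R : realType} {H : completeNormedModType R}.
Context {inner : {dot H for (idfun : R -> R)}}.
Hypothesis hinner : induces_norm inner.

Lemma innerC (x y : H) : inner x y = inner y x.
Proof. by rewrite hermC expr0 mul1r. Qed.

Lemma inner_norm (x : H) : inner x x = `|x| ^+ 2.
Proof.
rewrite hinner sqr_sqrtr //; have [->|x0] := eqVneq x 0.
  by rewrite linear0r.
by rewrite ltW // neq0_dnorm_gt0.
Qed.

Lemma innerZl a (x y : H) : inner (a *: x) y = a * inner x y.
Proof. exact: linearZl_LR. Qed.

Lemma innerZr a (x y : H) : inner x (a *: y) = a * inner x y.
Proof. exact: linearZr_LR. Qed.

Lemma innerDl (x y z : H) : inner (x + y) z = inner x z + inner y z.
Proof. exact: linearDl. Qed.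

Lemma innerDr (x y z : H) : inner x (y + z) = inner x y + inner x z.
Proof. exact: linearDr. Qed.

Lemma innerBl (x y z : H) : inner (x - y) z = inner x z - inner y z.
Proof. exact: linearBl. Qed.

Lemma innerBr (x y z : H) : inner x (y - z) = inner x y - inner x z.
Proof. exact: linearBr. Qed.

(* Polarization: [4 <B x, y> = <B (x + y), x + y> - <B (x - y), x - y>], then
   the parallelogram law, at [y = B x / c]. *)
Lemma self_adjoint_norm_le (B : {linear H -> H}) (c : R) :
  self_adjoint inner B -> 0 <= c ->
  (forall x, `|inner (B x) x| <= c * `|x| ^+ 2) ->
  forall x, `|B x| <= c * `|x|.
Proof.
move=> hB c0 hq x.
have polar y : inner (B x) y *+ 2 <= c * (`|x| ^+ 2 + `|y| ^+ 2).
  have := hq (x + y); have := hq (x - y); rewrite -!inner_norm.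
  rewrite [B (x + y)]linearD [B (x - y)]linearB.
  rewrite !innerBl !innerBr !innerDl !innerDr.
  rewrite (hB y x) (innerC y (B x)) (innerC y x) !ler_norml.
  by move=> /andP[? _] /andP[_ ?]; lra.
rewrite -ler_sqr ?nnegrE ?mulr_ge0 // exprMn.
(* The witness [B x / c] needs [c != 0]; for [c = 0], [y = B x] already forces [B x = 0]. *)
have [c0'|cN] := eqVneq c 0.
  have := polar (B x); rewrite c0' inner_norm mul0r expr0n mul0r.
  by rewrite pmulrn_lle0.
have cp : 0 < c by rewrite lt0r cN.
have := polar (c^-1 *: B x).
rewrite innerZr inner_norm normrZ exprMn ger0_norm ?invr_ge0 //.
(* With [c^-1] factored out on both sides, one of the two copies of [|B x| ^+ 2] on the left
   cancels. *)
have -> : c * (`|x| ^+ 2 + c^-1 ^+ 2 * `|B x| ^+ 2)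
  = c^-1 * (c ^+ 2 * `|x| ^+ 2 + `|B x| ^+ 2) by field.
by rewrite -mulrnAr ler_pM2l ?invr_gt0 // mulr2n lerD2r.
Qed.

(** Stands in for Cauchy-Schwarz: expand [0 <= |A x - b x|^2], bound [|A x|^2] by [b^2 |x|^2], and
    divide by [2 b]. *)
Lemma quadratic_form_le (A : {linear H -> H}) (b : R) (x : H) :
  0 < b -> `|A x| <= b * `|x| -> inner (A x) x <= b * `|x| ^+ 2.
Proof.
move=> b0 hA.
have sqA : `|A x| ^+ 2 <= b ^+ 2 * `|x| ^+ 2.
  by rewrite -exprMn ler_sqr ?nnegrE ?mulr_ge0 // ltW.
have : 0 <= inner (A x - b *: x) (A x - b *: x) by rewrite inner_norm sqr_ge0.
rewrite innerBl !innerBr !innerZl !innerZr (innerC x) !inner_norm => h.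
rewrite -(ler_pM2l b0); lra.
Qed.

(** For the form of [I - a A], [a * b <= 1] gives nonnegativity and strong positivity gives the
    upper bound; [a * gamma <= 1] makes the contraction constant nonnegative. *)
Lemma strongly_positive_contraction (A : {linear H -> H}) (gamma b a : R) :
  bounded_operator A -> self_adjoint inner A ->
  strongly_positive inner A gamma -> opnorm A <= b -> 0 < b ->
  0 < a -> a * b <= 1 -> a * gamma <= 1 ->
  forall x : H, `|x - a *: A x| <= (1 - a * gamma) * `|x|.
Proof.
move=> hA hsa hpos hb b0 a0 ab1 ag1.
apply: (@self_adjoint_norm_le (idfun \- a \*: A)).
- move=> x y /=.
  by rewrite innerBl innerBr innerZl innerZr hsa.
- by rewrite subr_ge0.
move=> x /=; rewrite innerBl innerZl inner_norm.
have hx2 : 0 <= `|x| ^+ 2 by rewrite sqr_ge0.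
have q1 : a * inner (A x) x <= `|x| ^+ 2.
  apply: (@le_trans _ _ (a * b * `|x| ^+ 2)); last by rewrite ler_piMl.
  rewrite -mulrA ler_pM2l // quadratic_form_le //.
  by apply: le_trans (opnorm_bound _ _ _ hA x) _; rewrite ler_wpM2r.
rewrite ger0_norm ?subr_ge0 // mulrBl mul1r lerD2l lerN2 -mulrA ler_pM2l //.
Qed.

End Hilbert.

Theorem theorem6 (R : realType) (H : completeNormedModType R)
  (inner : {dot H for (idfun : R -> R)}) (hinner : induces_norm inner)
  (A : {linear H -> H}) (gamma : R)
  (hAbounded : bounded_operator A) (hAself : self_adjoint inner A)
  (hgamma0 : 0 < gamma) (hgamma1 : gamma <= 1)
  (hApos : strongly_positive inner A gamma)
  (l : nat) (hl : (0 < l)%N) (T : 'I_l -> H -> H)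
  (hT : forall i : 'I_l, nonexpansive (T i))
  (hF : \bigcap_i Fix (T i) !=set0)
  (u : H) (alpha : nat -> R) (halpha : forall n : nat, 0 < alpha n <= 1)
  (x : nat -> H) (hx : xu_iteration A (cyclic hl T) u alpha x)
  (p : H) (hp : (\bigcap_i Fix (T i)) p)
  (bA : nat) (hbA0 : (0 < bA)%N) (hbA : opnorm A <= bA%:R)
  (sigma1 : nat -> nat) (hC1 : C1q alpha sigma1)
  (Q : nat) (hQ : Q = maxn (sigma1 (bA - 1)%N - 1)%N 0%N)
  (K : nat) (hK0 : (0 < K)%N)
  (hK : Num.max `|x Q - p| (`|u - A p| / gamma) <= K%:R)
  (Phi : nat -> nat) (hPhi : seq_regularity_rate (Ttilde hl T) x Phi)
  (hPhiQ : forall k : nat, (Q <= Phi k)%N)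
  (tau : nat -> nat) (htau_mono : nat_monotone tau)
  (htau : forall (k m : nat) (y : H), closed_ball_ Num.norm p K%:R y ->
     `|y - Ttilde hl T m y| <= (tau k).+1%:R^-1 ->
     forall i : 'I_l, `|y - T i y| < k.+1%:R^-1) :
  forall i : 'I_l, regularity_rate (T i) x (fun k : nat => Phi (tau k)).
Proof.
have gK : `|u - A p| <= gamma * K%:R.
  by move: hK; rewrite ge_max ler_pdivrMr // mulrC => /andP[_].
have bR : 0 < bA%:R :> R by rewrite ltr0n.
(* The shift by one in [Q] matches the index of [alpha n.+1]: [Q <= n] means
   [sigma1 (bA - 1) <= n.+1], even when the subtraction truncates. *)
have alpha_bA n : (Q <= n)%N -> alpha n.+1 * bA%:R <= 1.
  move=> Qn; rewrite -ler_pdivlMr // mul1r.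
  have := hC1.2 (bA - 1)%N n.+1; rewrite subn1 prednK //; apply.
  by move: Qn; rewrite hQ maxn0 leq_subLR add1n subn1.
have bounded n : (Q <= n)%N -> `|x n - p| <= K%:R.
  (* Induction runs from 0, so the starting index [Q] appears as [n = 0] or as a successor equal to
     [Q]. *)
  elim: n => [|n IH] Qn.
    by move: Qn hK; rewrite leqn0 ge_max => /eqP -> /andP[].
  move: Qn; rewrite leq_eqVlt => /predU1P[<-|Qn].
    by move: hK; rewrite ge_max => /andP[].
  have {IH}IH := IH Qn; have /andP[a0 a1] := halpha n.+1.
  have ag : alpha n.+1 * gamma <= 1 by rewrite mulr_ile1 // ltW.
  set t := cyclic hl T n.+1 (x n).
  have tp : `|t - p| <= K%:R.
    (* Writing [p] as its own image under the map that produced [t] makes nonexpansiveness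
       applicable. *)
    apply: le_trans IH; rewrite -[X in t - X](hp (Ordinal (ltn_pmod n.+1 hl)) I).
    exact: hT.
  have -> : x n.+1 - p = ((t - p) - alpha n.+1 *: A (t - p))
                         + alpha n.+1 *: (u - A p).
    rewrite hx /= -/t linearB !scalerBr opprB.
    rewrite -[RHS]addrA [X in _ = _ + X]addrC subrKA addrA.
    by rewrite (ACl (1*4*3*2))%AC.
  apply: le_trans (ler_normD _ _) _.
  have -> : K%:R = (1 - alpha n.+1 * gamma) * K%:R
                   + alpha n.+1 * (gamma * K%:R) :> R by ring.
  apply: lerD; last by rewrite normrZ gtr0_norm // ler_pM2l.
  apply: le_trans (strongly_positive_contraction hinner A _ _ _
    hAbounded hAself hApos hbA bR a0 (alpha_bA n Qn) ag _) _.
  by rewrite ler_wpM2l // subr_ge0.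
(* Take [m = n], since [Phi] controls [Ttilde hl T n] at [x n]; [Q <= Phi (tau k) <= n] puts [x n]
   in the ball. *)
move=> i k n hn; apply/ltW/(htau k n).
  by rewrite /closed_ball_ /= distrC bounded // (leq_trans (hPhiQ _) hn).
exact: hPhi.
Qed.
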